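(* Let $m,n$ be positive integers, let $N=\{1,\ldots,n\}$, and let $\mathcal{A}=(a_{i_1\cdots i_m})$ be a real $m$-th order $n$-dimensional tensor. Suppose that there exists an index set $J_0\subseteq N$ with $|J_0|=l$ such that $a_{ii_2\cdots i_m}>0$ for any $i\in J_0$ and any $i_2,\ldots,i_m\in N\setminus\{i\}$. Moreover, suppose that $-\mathcal{A}$ is a $Z$-tensor. Then $\mathcal{A}$ has at most $\alpha^l_n:=2^{n-l}$ Pareto-eigenvalues.
   Context: A real $m$-th order $n$-dimensional tensor is an array $\mathcal{A}=(a_{i_1\cdots i_m})$ with $a_{i_1\cdots i_m}\in\mathbb{R}$ for $1\le i_1,\ldots,i_m\le n$. For $x\in\mathbb{R}^n$, $\mathcal{A}x^{m-1}\in\mathbb{R}^n$ is the vector with $(\mathcal{A}x^{m-1})_i=\sum_{i_2,\ldots,i_m=1}^n a_{ii_2\cdots i_m}x_{i_2}\cdots x_{i_m}$, and $x^{[m-1]}=(x_1^{m-1},\ldots,x_n^{m-1})^\top$. Vector inequalities are componentwise. A tensor is a $Z$-tensor if all its off-diagonal entries (those whose indices $i_1,\ldots,i_m$ are not all equal) are nonpositive. A Pareto-eigenvalue of $\mathcal{A}$ is a real number $\lambda$ for which there exists $x\in\mathbb{R}^n\setminus\{0\}$ with $x\ge 0$, $\lambda x^{[m-1]}-\mathcal{A}x^{m-1}\ge 0$ and $\langle x,\lambda x^{[m-1]}-\mathcal{A}x^{m-1}\rangle=0$. *)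

(* Defs.v *)
From mathcomp Require Import all_boot all_order all_algebra.
From mathcomp Require Import classical_sets cardinality reals.

Set Implicit Arguments.
Unset Strict Implicit.
Unset Printing Implicit Defensive.

Import Order.TTheory GRing.Theory Num.Theory.
Local Open Scope ring_scope.

(* Only tensors of positive order occur: order m.+1 below is the order "m" of
   the mathematical text, so its exponent m - 1 is m here.  Finite functions
   make - A available as the opposite in a zmodType. *)
Definition tensor (R : realType) (m n : nat) := {ffun m.-tuple 'I_n -> R}.

Definition tensor_app (R : realType) (m n : nat)
    (A : tensor R m.+1 n) (x : 'cV[R]_n) : 'cV[R]_n :=
  \col_i \sum_(t : m.-tuple 'I_n)
    A [tuple of i :: t] * \prod_(k < m) x (tnth t k) 0.

(* When m = 0 every coordinate is 1, since 0 ^+ 0 = 1. *)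
Definition vec_pow (R : realType) (m n : nat) (x : 'cV[R]_n) : 'cV[R]_n :=
  \col_i x i 0 ^+ m.

Definition vec_ge0 (R : realType) (n : nat) (x : 'cV[R]_n) : Prop :=
  forall i, 0 <= x i 0.

Definition inner (R : realType) (n : nat) (x y : 'cV[R]_n) : R :=
  \sum_i x i 0 * y i 0.

Definition Z_tensor (R : realType) (m n : nat) (A : tensor R m n) : Prop :=
  forall t : m.-tuple 'I_n, ~~ constant t -> A t <= 0.

Definition pareto_eigenvalue (R : realType) (m n : nat)
    (A : tensor R m.+1 n) (lambda : R) : Prop :=
  exists x : 'cV[R]_n,
    let w := lambda *: vec_pow m x - tensor_app A x in
    [/\ x != 0, vec_ge0 x, vec_ge0 w & inner x w = 0].

(* Main.v *)
(* A Pareto-eigenvector x with support J solves the eigenvalue equation on J.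
   Off the diagonal A is nonnegative, so scaling y to touch x from below gives
   monotonicity of eigenvalues in the support; in particular each support
   carries at most one eigenvalue.  For order at least 2 the support contains
   J0: at i in J0 outside the support, the i-th coordinate of A x^(m-1) would be
   positive.  Complements of supports thus inject the eigenvalues into the
   subsets of the complement of J0.  For order 1 the only eigenvalue is the
   largest entry of A. *)
Require Import Defs.
From mathcomp Require Import all_boot all_order all_algebra.
From mathcomp Require Import classical_sets cardinality reals.

Set Implicit Arguments.
Unset Strict Implicit.
Unset Printing Implicit Defensive.

Import Order.TTheory GRing.Theory Num.Theory.
Local Open Scope classical_set_scope.
Local Open Scope card_scope.
Local Open Scope ring_scope.

Definition supp (R : realType) (n : nat) (x : 'cV[R]_n) : {set 'I_n} :=
  [set i | x i 0 != 0]%SET.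

Definition pareto_pair (R : realType) (m n : nat) (A : tensor R m.+1 n)
    (lambda : R) (x : 'cV[R]_n) : Prop :=
  let w := lambda *: vec_pow m x - tensor_app A x in
  [/\ x != 0, vec_ge0 x, vec_ge0 w & inner x w = 0].

Lemma supp_gt0 (R : realType) (n : nat) (x : 'cV[R]_n) (i : 'I_n) :
  vec_ge0 x -> (i \in supp x) = (0 < x i 0).
Proof. by move=> x0; rewrite inE lt0r x0 andbT. Qed.

Lemma supp_exists (R : realType) (n : nat) (x : 'cV[R]_n) :
  x != 0 -> exists i, i \in supp x.
Proof.
move=> xn0; apply/existsP; apply: contraNT xn0 => /existsPn xi0.
by apply/eqP/colP => i; rewrite mxE; have := xi0 i; rewrite inE negbK => /eqP.
Qed.

Lemma pareto_pair_ge (R : realType) (m n : nat) (A : tensor R m.+1 n)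
    (lambda : R) (x : 'cV[R]_n) (i : 'I_n) :
  pareto_pair A lambda x -> tensor_app A x i 0 <= lambda * x i 0 ^+ m.
Proof. by case=> _ _ /(_ i) + _; rewrite !mxE subr_ge0. Qed.

(** Complementarity: [inner x w] is a vanishing sum of nonnegative terms, so each term is zero and
    [w] vanishes on the support. *)
Lemma pareto_pair_eq (R : realType) (m n : nat) (A : tensor R m.+1 n)
    (lambda : R) (x : 'cV[R]_n) (i : 'I_n) :
  pareto_pair A lambda x -> i \in supp x ->
  tensor_app A x i 0 = lambda * x i 0 ^+ m.
Proof.
case=> _ x0 w0 /eqP; rewrite psumr_eq0 => [|j _]; last exact: mulr_ge0.
move=> /allP /(_ i (mem_index_enum _)) /=; rewrite mulf_eq0 inE.
by case/orP=> [-> //|]; rewrite !mxE subr_eq0 => /eqP.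
Qed.

Lemma offdiag_ge0 (R : realType) (m n : nat) (A : tensor R m n)
    (t : m.-tuple 'I_n) : Z_tensor (- A) -> ~~ constant t -> 0 <= A t.
Proof. by move=> hZ /hZ; rewrite ffunE oppr_le0. Qed.

(** Off-diagonal entries are nonnegative, so their terms grow with the vector. The diagonal entry
    may have any sign, but it multiplies a power of the [i]-th coordinate, on which [x] and [y]
    agree. *)
Lemma tensor_app_le (R : realType) (m n : nat) (A : tensor R m.+1 n)
    (x y : 'cV[R]_n) (i : 'I_n) :
  Z_tensor (- A) -> vec_ge0 y -> (forall j, y j 0 <= x j 0) ->
  y i 0 = x i 0 -> tensor_app A y i 0 <= tensor_app A x i 0.
Proof.
move=> hZ y0 yx yxi; rewrite !mxE; apply: ler_sum => t _.
case: (boolP (constant [tuple of i :: t])) => [/= /all_tnthP ti|nct].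
  have ti' k : tnth t k = i by apply/eqP; have := ti k; rewrite /= eq_sym.
  suff -> : \prod_(k < m) y (tnth t k) 0 = \prod_(k < m) x (tnth t k) 0 by [].
  by apply: eq_bigr => k _; rewrite ti' yxi.
apply: ler_wpM2l; first exact: offdiag_ge0.
by apply: ler_prod => k _; rewrite y0 yx.
Qed.

Lemma tensor_appZ (R : realType) (m n : nat) (A : tensor R m.+1 n)
    (c : R) (y : 'cV[R]_n) (i : 'I_n) :
  tensor_app A (c *: y) i 0 = c ^+ m * tensor_app A y i 0.
Proof.
rewrite !mxE big_distrr; apply: eq_bigr => t _.
under eq_bigr do rewrite mxE.
by rewrite big_split prodr_const card_ord mulrCA.
Qed.

Lemma pareto_pair_mono (R : realType) (m n : nat) (A : tensor R m.+1 n)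
    (lambda mu : R) (x y : 'cV[R]_n) :
  Z_tensor (- A) -> pareto_pair A lambda x -> pareto_pair A mu y ->
  supp y \subset supp x -> mu <= lambda.
Proof.
move=> hZ hx hy yx; have [_ x0 _ _] := hx; have [yn0 y0 _ _] := hy.
have [i0 i0y] := supp_exists yn0.
(* The least ratio over [supp y] is the largest [c] with [c *: y] below [x]; the two vectors touch
   at the minimizer [i]. *)
case: (arg_minP (fun j => x j 0 / y j 0) i0y) => i iy imin.
have ix := fintype.subsetP yx _ iy.
have yi0 : 0 < y i 0 by rewrite -supp_gt0.
have xi0 : 0 < x i 0 by rewrite -supp_gt0.
pose c := x i 0 / y i 0.
have c0 : 0 < c by rewrite divr_gt0.
have cyi : c * y i 0 = x i 0 by rewrite divfK ?gt_eqF.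
have cy_ge0 : vec_ge0 (c *: y) by move=> j; rewrite mxE mulr_ge0 // ltW.
have cy_le j : (c *: y) j 0 <= x j 0.
  rewrite mxE; have [jy|] := boolP (j \in supp y).
    by rewrite -ler_pdivlMr ?imin // -supp_gt0.
  by rewrite inE negbK => /eqP ->; rewrite mulr0.
have cy_eq : (c *: y) i 0 = x i 0 by rewrite mxE.
(* At the touching coordinate the comparison reads [mu * x i 0 ^+ m <= lambda * x i 0 ^+ m], and the
   positive power cancels. *)
have := tensor_app_le hZ cy_ge0 cy_le cy_eq.
rewrite tensor_appZ (pareto_pair_eq hx ix) (pareto_pair_eq hy iy).
by rewrite mulrCA -exprMn cyi ler_pM2r // exprn_gt0.
Qed.

Lemma pareto_pair_supp (R : realType) (m n : nat) (A : tensor R m.+2 n)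
    (lambda : R) (x : 'cV[R]_n) (i : 'I_n) :
  Z_tensor (- A) -> pareto_pair A lambda x ->
  (forall t : m.+1.-tuple 'I_n, i \notin t -> 0 < A [tuple of i :: t]) ->
  i \in supp x.
Proof.
move=> hZ hx Apos; have [xn0 x0 _ _] := hx; apply: contraT => ix.
have xi0 : x i 0 = 0 by move: ix; rewrite inE negbK => /eqP.
have [j jx] := supp_exists xn0.
(* The exponent is [m.+1], so the power of the zero coordinate vanishes; this fails at order 1. *)
have := pareto_pair_ge i hx; rewrite xi0 expr0n mulr0 leNgt => /negP[].
have prod_ge0 t : 0 <= \prod_(k < m.+1) x (tnth t k) 0 by apply: prodr_ge0.
(* The constant tuple at a support index [j] avoids [i] and supplies a strictly positive term. *)
have iN_nseq : i \notin nseq_tuple m.+1 j.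
  by rewrite mem_nseq /=; apply: contraNneq ix => ->.
rewrite mxE (bigD1 (nseq_tuple m.+1 j)) //= ltr_pwDl //.
  rewrite mulr_gt0 ?Apos // prodr_gt0 // => k _.
  by rewrite tnth_nseq -supp_gt0.
(* A tuple through [i] contributes the factor [x i 0 = 0]; any other tuple has a positive entry. *)
apply: sumr_ge0 => t _; have [/tnthP[k ik]|it] := boolP (i \in t).
  by rewrite (bigD1 k) //= -ik xi0 mul0r mulr0.
by rewrite mulr_ge0 // ltW ?Apos.
Qed.

(** With exponent 0, both sides of the eigenvalue inequality lose their dependence on the vector:
    [lambda] bounds every entry of [A], and [mu] is one of them. *)
Lemma pareto_pair_order1 (R : realType) (n : nat) (A : tensor R 1 n)
    (lambda mu : R) (x y : 'cV[R]_n) :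
  pareto_pair A lambda x -> pareto_pair A mu y -> mu <= lambda.
Proof.
move=> hx hy; have [yn0 _ _ _] := hy; have [i iy] := supp_exists yn0.
have := pareto_pair_ge i hx; have := pareto_pair_eq hy iy.
rewrite !expr0 !mulr1 => <-; apply: le_trans; rewrite !mxE.
by apply: ler_sum => t _; rewrite !big_ord0.
Qed.

Lemma card_le_powerset (T : Type) (n : nat) (E : set T) (J : {set 'I_n})
    (S : T -> {set 'I_n}) :
  (forall a, E a -> J \subset S a) ->
  (forall a b, E a -> E b -> S a = S b -> a = b) ->
  E #<= `I_(2 ^ (n - #|J|))%N.
Proof.
move=> JS Sinj; pose s := enum (powerset (~: J)%SET).
have Ss a : E a -> (~: S a)%SET \in s.
  by move=> /JS; rewrite mem_enum powersetE finset.setCS.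
have -> : (2 ^ (n - #|J|) = size s)%N.
  by rewrite -cardE card_powerset (cardsCs (~: J)%SET) finset.setCK card_ord.
(* The position of the complement of [S a] in the list of subsets of [~: J] serves as the numerical
   code of [a]. *)
apply/pcard_leP/injfunPex; exists (fun a => index (~: S a)%SET s).
  by move=> a /Ss; rewrite -index_mem.
move=> a b /set_mem Ea /set_mem Eb /(congr1 (nth finset.set0 s)).
by rewrite !nth_index ?Ss // => /finset.setC_inj; apply: Sinj.
Qed.

Unset Implicit Arguments.
Set Strict Implicit.

Theorem proposition4p5 (R : realType) (m n l : nat) (hn : (0 < n)%N)
    (A : tensor R m.+1 n) (J0 : {set 'I_n}) (hl : #|J0| = l)
    (hpos : forall i : 'I_n, i \in J0 ->
       forall t : m.-tuple 'I_n, i \notin t -> 0 < A [tuple of i :: t])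
    (hZ : Z_tensor (- A)) :
  [set lambda : R | pareto_eigenvalue A lambda] #<= `I_(2 ^ (n - l))%N.
Proof.
rewrite -hl; case: m A hpos hZ => [|m] A hpos hZ.
  (* At order 1 supports may miss [J0], but all eigenvalues coincide, so a constant map is already
     injective on them. *)
  apply: (@card_le_powerset _ _ _ _ (fun=> finset.setT)) => [a _|a b].
    exact: finset.subsetT.
  move=> [x hx] [y hy] _; apply: le_anti.
  by rewrite (pareto_pair_order1 hx hy) (pareto_pair_order1 hy hx).
(* A chosen eigenvector for each eigenvalue; the default 0 is taken only at non-eigenvalues. *)
pose v a := xget 0 (pareto_pair A a).
have hv a : pareto_eigenvalue A a -> pareto_pair A a (v a).
  by case=> x hx; apply: (xgetPex 0); exists x.
apply: (@card_le_powerset _ _ _ _ (fun a => supp (v a))) => [a /hv ha|a b].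
  by apply/fintype.subsetP => i iJ; apply: pareto_pair_supp hZ ha (hpos i iJ).
move=> /hv ha /hv hb ab; apply: le_anti.
by rewrite (pareto_pair_mono hZ hb ha) ?(pareto_pair_mono hZ ha hb) ?ab.
Qed.
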